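(* The family $\bigcup_{p\in\mathbb Z} D_p$, where $D_p=\{D_{p,\tau}\}_{\tau=0}^{\beta(|p|)-1}$, is an orthonormal basis of $L^2([0,1])$.
   Context: Define $\nu,\beta$ on $\mathbb N$ by $\nu(0)=0,\ \beta(0)=1$; $\nu(1)=1,\ \beta(1)=1$; and for $p\ge 2$, $\nu(p)=2^{p-1}+2^{p-2}$, $\beta(p)=2^{p-1}$. Set $\nu(-p)=-\nu(p)$ and $\beta(-p)=\beta(p)$. The DOST functions are: $D_{0,0}(t)=D_0(t)=1$; $D_{1,0}(t)=e^{2\pi i t}$; for $p\ge 2$ and $\tau=0,\dots,\beta(p)-1$, $$D_{p,\tau}(t)=\frac{1}{\sqrt{\beta(p)}}\sum_{f=\nu(p)-\beta(p)/2}^{\nu(p)+\beta(p)/2-1} e^{2\pi i f t}\,e^{-2\pi i f\tau/\beta(p)}=\frac{1}{\sqrt{\beta(p)}}\sum_{j=0}^{\beta(p)-1}e^{2\pi i(\beta(p)+j)(t-\tau/\beta(p))};$$ and for negative integers $p$, $D_{p,\tau}=\overline{D_{-p,\tau}}$, $\tau=0,\dots,\beta(|p|)-1$. Here $L^2([0,1])$ is the space of square-integrable 1-periodic functions with inner product $(f,g)=\int_0^1 f\bar g\,dt$. *)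

(* Defs.v *)
From mathcomp Require Import all_boot all_order all_algebra.
From mathcomp Require Import all_classical all_reals all_analysis.
From mathcomp Require Import complex.

Set Implicit Arguments.
Unset Strict Implicit.
Unset Printing Implicit Defensive.

Import Order.TTheory GRing.Theory Num.Theory.
Local Open Scope ring_scope.
Local Open Scope classical_set_scope.

Definition nu (p : nat) : nat :=
  match p with
  | 0 => 0
  | 1 => 1
  | _ => (2 ^ (p - 1) + 2 ^ (p - 2))%N
  end.

Definition beta (p : nat) : nat :=
  match p with
  | 0 => 1
  | 1 => 1
  | _ => (2 ^ (p - 1))%N
  end.

Definition expi {R : realType} (x : R) : R[i] := Complex (cos x) (sin x).

Definition cR {R : realType} (x : R) : R[i] := Complex x 0.

Definition DOSTnat {R : realType} (p tau : nat) (t : R) : R[i] :=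
  match p with
  | 0 => 1
  | 1 => expi (2 * pi * t)
  | _ =>
    cR (Num.sqrt ((beta p)%:R))^-1 *
    \sum_((nu p - (beta p) %/ 2)%N <= f < (nu p + (beta p) %/ 2)%N)
       (expi (2 * pi * f%:R * t) *
        expi (- (2 * pi * f%:R * tau%:R / (beta p)%:R)))
  end.

Definition DOST {R : realType} (p : int) (tau : nat) (t : R) : R[i] :=
  match p with
  | Posz n => DOSTnat n tau t
  | Negz n => (DOSTnat n.+1 tau t)^*%C   (* Negz n = -(n+1) *)
  end.

Definition DOST_index (p : int) (tau : nat) : bool := (tau < beta `|p|)%N.

Definition I01 {R : realType} : set R := `[0, 1]%classic.

Definition sqnorm {R : realType} (z : R[i]) : R := complex.Re z ^+ 2 + complex.Im z ^+ 2.

Definition cint01 {R : realType} (h : R -> R[i]) : R[i] :=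
  Complex (Rintegral (@lebesgue_measure R) (@I01 R) (fun t => complex.Re (h t)))
          (Rintegral (@lebesgue_measure R) (@I01 R) (fun t => complex.Im (h t))).

Definition inner01 {R : realType} (f g : R -> R[i]) : R[i] :=
  cint01 (fun t => f t * (g t)^*%C).

Definition L2_01 {R : realType} (f : R -> R[i]) : Prop :=
  measurable_fun (@I01 R) (fun t => complex.Re (f t)) /\
  measurable_fun (@I01 R) (fun t => complex.Im (f t)) /\
  (\int[@lebesgue_measure R]_(t in @I01 R) (sqnorm (f t))%:E < +oo)%E.

Definition L2dist2 {R : realType} (f g : R -> R[i]) : \bar R :=
  (\int[@lebesgue_measure R]_(t in @I01 R) (sqnorm (f t - g t))%:E)%E.

Definition orthonormal_basis_L2_01 {R : realType} {I : eqType}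
    (valid : pred I) (e : I -> R -> R[i]) : Prop :=
  (forall i, valid i -> L2_01 (e i)) /\
  (forall i j, valid i -> valid j ->
     inner01 (e i) (e j) = if i == j then 1 else 0) /\
  (forall f : R -> R[i], L2_01 f ->
     forall eps : R, 0 < eps ->
     exists s : seq (I * R[i]),
       all (fun x => valid x.1) s /\
       (L2dist2 f (fun t => (\sum_(x <- s) x.2 * e x.1 t)%R) < eps%:E)%E).

(* Main.v *)
(** On the band p = n + 1 the DOST functions are obtained from the exponentials
    e^{2 pi i f t}, 2^n <= f < 2^{n+1}, by a unitary (Fourier) matrix, and the
    bands with their conjugates partition the nonzero integers. Hence the family
    is orthonormal and has the same span as the exponentials, and it remains to
    see that trigonometric polynomials are dense in L^2([0,1]).

    Let F_N(u) = |sum_{k<N} e^{2 pi i k u}|^2 / N^2 be the Fejer kernel. Since it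
    has degree less than N, sum_{j<N} F_N(t - j/N) = 1 exactly, while
    F_N(u) |1 - e^{2 pi i u}|^2 = |1 - e^{2 pi i N u}|^2 / N^2 <= 4 / N^2. So the
    discrete Fejer means sum_{j<N} g(j/N) F_N(t - j/N) of a bounded continuous g
    are bounded trigonometric polynomials which converge to g(t) for 0 < t < 1
    (no periodicity of g is needed), and dominated convergence gives convergence
    in L^2. Bounded continuous functions are dense in L^2: truncate, then
    approximate in L^1. *)

Require Import Defs.
From mathcomp Require Import all_boot all_order all_algebra.
From mathcomp Require Import all_classical all_reals all_analysis.
From mathcomp Require Import measurable_realfun complex ring lra zify.

Set Implicit Arguments.
Unset Strict Implicit.
Unset Printing Implicit Defensive.

Import Order.TTheory GRing.Theory Num.Theory.
Import numFieldNormedType.Exports.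
Local Open Scope ring_scope.
Local Open Scope classical_set_scope.

(** * Complex exponentials and the Fejer kernel *)

Section ComplexParts.
Variable R : realType.
Implicit Types (z w : R[i]) (x y : R).

Lemma complexP z w : complex.Re z = complex.Re w ->
  complex.Im z = complex.Im w -> z = w.
Proof. by case: z => a b; case: w => c d /= -> ->. Qed.

Lemma cReD z w : complex.Re (z + w) = complex.Re z + complex.Re w.
Proof. by case: z; case: w. Qed.

Lemma cImD z w : complex.Im (z + w) = complex.Im z + complex.Im w.
Proof. by case: z; case: w. Qed.

Lemma cReN z : complex.Re (- z) = - complex.Re z.
Proof. by case: z. Qed.

Lemma cImN z : complex.Im (- z) = - complex.Im z.
Proof. by case: z. Qed.

Lemma cReM z w : complex.Re (z * w) =
  complex.Re z * complex.Re w - complex.Im z * complex.Im w.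
Proof. by case: z; case: w. Qed.

Lemma cImM z w : complex.Im (z * w) =
  complex.Re z * complex.Im w + complex.Im z * complex.Re w.
Proof. by case: z; case: w. Qed.

Lemma conjcM z w : (z * w)^*%C = z^*%C * w^*%C.
Proof. exact: rmorphM. Qed.

Lemma cRe_sum I (r : seq I) (F : I -> R[i]) :
  complex.Re (\sum_(i <- r) F i) = \sum_(i <- r) complex.Re (F i).
Proof. by apply: (big_morph _ cReD). Qed.

Lemma cIm_sum I (r : seq I) (F : I -> R[i]) :
  complex.Im (\sum_(i <- r) F i) = \sum_(i <- r) complex.Im (F i).
Proof. by apply: (big_morph _ cImD). Qed.

Lemma cRM x y : cR (x * y) = cR x * cR y.
Proof. by apply: complexP; rewrite /= ?mulr0 ?mul0r ?subr0 ?addr0. Qed.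

Lemma cR_nat n : cR (n%:R : R) = n%:R.
Proof. exact: (rmorph_nat (real_complex R)). Qed.

Lemma cRV x : cR x^-1 = (cR x)^-1.
Proof. exact: (fmorphV (real_complex R)). Qed.

Lemma cR_sum I (r : seq I) (F : I -> R) :
  cR (\sum_(i <- r) F i) = \sum_(i <- r) cR (F i).
Proof. exact: (rmorph_sum (real_complex R)). Qed.

Lemma sqnormM z w : sqnorm (z * w) = sqnorm z * sqnorm w.
Proof. by rewrite /sqnorm cReM cImM; ring. Qed.

Lemma cR_sqnorm z : cR (sqnorm z) = z * z^*%C.
Proof. by case: z => a b; apply: complexP; rewrite /sqnorm /=; ring. Qed.

Lemma sqnorm_ge0 z : 0 <= sqnorm z.
Proof. by rewrite addr_ge0 ?sqr_ge0. Qed.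

End ComplexParts.

Section Expi.
Variable R : realType.
Implicit Types (x y : R).

Lemma expiD x y : expi (x + y) = expi x * expi y.
Proof. by apply: complexP; rewrite /= ?cosD ?sinD; ring. Qed.

Lemma expi0 : expi 0 = 1 :> R[i].
Proof. by rewrite /expi cos0 sin0. Qed.

Lemma expiN x : expi (- x) = (expi x)^*%C.
Proof. by rewrite /expi cosN sinN. Qed.

Lemma expiMn x n : expi (x *+ n) = expi x ^+ n.
Proof.
elim: n => [|n IHn]; first by rewrite mulr0n expi0.
by rewrite mulrS expiD IHn exprS.
Qed.

Lemma expi2pi : expi (2 * pi) = 1 :> R[i].
Proof. by rewrite mulr_natl /expi cos2pi sin2pi. Qed.

Lemma expi2pi_int (k : int) : expi (2 * pi * k%:~R) = 1 :> R[i].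
Proof.
suff H (n : nat) : expi (2 * pi * n%:R) = 1 :> R[i].
  case: k => n; rewrite ?NegzE; first exact: H.
  by rewrite mulrNz mulrN expiN H conjc1.
by rewrite mulr_natr expiMn expi2pi expr1n.
Qed.

Lemma expi2pi_neq1 x : 0 < x < 1 -> expi (2 * pi * x) != 1 :> R[i].
Proof.
move=> /andP[x0 x1]; apply/negP => /eqP [] cos1 _.
have s0 : 0 < sin (pi * x).
  by apply: sin_gt0_pi; rewrite mulr_gt0 ?pi_gt0//= gtr_pMr ?pi_gt0.
have : cos ((pi * x) *+ 2) = 1 by rewrite -cos1; congr cos; ring.
rewrite cos_mulr2n; have := cos2Dsin2 (pi * x) => H1 H2.
have /eqP : sin (pi * x) ^+ 2 = 0 by move: H1 H2; lra.
by rewrite sqrf_eq0 gt_eqF.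
Qed.

Lemma sqnorm_1Bexpi x : sqnorm (1 - expi x) = 2 - 2 * cos x.
Proof.
rewrite /sqnorm cReD cReN cImD cImN /=.
by have := cos2Dsin2 x; lra.
Qed.

Lemma sum_expi_roots (N k l : nat) : (k < N)%N -> (l < N)%N ->
  \sum_(j < N) expi (2 * pi * j%:R * (k%:R - l%:R) / N%:R) =
  if k == l then N%:R else 0 :> R[i].
Proof.
move=> kN lN; have N0 : 0 < N%:R :> R by rewrite ltr0n (leq_ltn_trans _ kN).
pose z : R[i] := expi (2 * pi * ((k%:R - l%:R) / N%:R)).
have -> : \sum_(j < N) expi (2 * pi * j%:R * (k%:R - l%:R) / N%:R) =
    \sum_(j < N) z ^+ j.
  apply: eq_bigr => j _; rewrite -expiMn -mulr_natr; congr expi; ring.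
case: eqVneq => [kl|kl].
  rewrite /z kl subrr mul0r mulr0 expi0.
  by under eq_bigr do rewrite expr1n; rewrite sumr_const card_ord.
have zN : z ^+ N = 1.
  rewrite -expiMn -(expi2pi_int (k%:Z - l%:Z)) -mulr_natr; congr expi.
  by rewrite intrB; field; rewrite gt_eqF.
have z1 : z != 1.
  rewrite /z; have [lk|kl'|/eqP] := ltngtP l k; last by rewrite eq_sym (negbTE kl).
    apply: expi2pi_neq1; rewrite divr_gt0 ?subr_gt0 ?ltr_nat//=.
    by rewrite ltr_pdivrMr// mul1r -natrB ?ltr_nat; lia.
  rewrite -opprB mulNr mulrN expiN -(conjc1 R).
  apply/negP => /eqP /(can_inj (@conjcK _)) /eqP; apply/negP.
  apply: expi2pi_neq1; rewrite divr_gt0 ?subr_gt0 ?ltr_nat//=.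
  by rewrite ltr_pdivrMr// mul1r -natrB ?ltr_nat; lia.
apply/eqP; have /eqP : (z - 1) * \sum_(j < N) z ^+ j = 0.
  by rewrite -subrX1 zN subrr.
by rewrite mulf_eq0 subr_eq0 (negbTE z1).
Qed.

Definition fexp (k : int) (t : R) : R[i] := expi (2 * pi * k%:~R * t).

Lemma fexpD k l t : fexp (k + l) t = fexp k t * fexp l t.
Proof. by rewrite /fexp intrD -expiD; congr expi; ring. Qed.

Lemma fexpN k t : fexp (- k) t = (fexp k t)^*%C.
Proof. by rewrite /fexp intrN -expiN; congr expi; ring. Qed.

Lemma fexp_tD k (t u : R) : fexp k (t + u) = fexp k t * fexp k u.
Proof. by rewrite /fexp mulrDr expiD. Qed.

Lemma fexp0 t : fexp 0 t = 1.
Proof. by rewrite /fexp mulr0 mul0r expi0. Qed.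

End Expi.

Section Fejer.
Variable R : realType.

Definition fejer (N : nat) (t : R) : R :=
  sqnorm (\sum_(k < N) fexp k t) / N%:R ^+ 2.

Lemma fejer_ge0 N t : 0 <= fejer N t.
Proof. by rewrite divr_ge0 ?sqnorm_ge0// exprn_ge0. Qed.

Lemma fejer_fexp N t : cR (fejer N t) =
  (N%:R ^+ 2)^-1 * \sum_(k < N) \sum_(l < N) fexp (k%:Z - l%:Z) t.
Proof.
rewrite cRM cRV mulrC -natrX cR_nat natrX; congr (_ * _).
rewrite cR_sqnorm rmorph_sum mulr_suml; apply: eq_bigr => k _.
rewrite mulr_sumr; apply: eq_bigr => l _.
by rewrite fexpD fexpN.
Qed.

Lemma sum_fejer N t : (0 < N)%N ->
  \sum_(j < N) fejer N (t - j%:R / N%:R) = 1.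
Proof.
move=> N0; have NR : N%:R != 0 :> R[i] by rewrite pnatr_eq0 -lt0n.
have NR' : N%:R != 0 :> R by rewrite pnatr_eq0 -lt0n.
suff : cR (\sum_(j < N) fejer N (t - j%:R / N%:R)) = 1 by case.
rewrite cR_sum; under eq_bigr => j _ do rewrite fejer_fexp.
rewrite -mulr_sumr exchange_big /=.
under eq_bigr => k _.
  rewrite exchange_big /=.
  under eq_bigr => l _.
    under eq_bigr => j _ do rewrite fexp_tD.
    rewrite -mulr_sumr.
    rewrite (_ : \sum_(j < N) _ = if l == k then N%:R else 0); last first.
      rewrite -(inj_eq val_inj) -(sum_expi_roots R (ltn_ord l) (ltn_ord k)) /=.
      by apply: eq_bigr => j _; rewrite /fexp intrB; congr expi; field.
    over.
  rewrite (bigD1 k)//= eqxx subrr fexp0 mul1r big1 ?addr0; last first.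
    by move=> l /negbTE ->; rewrite mulr0.
  over.
by rewrite sumr_const card_ord -[X in _ * X]mulr_natr -expr2 mulVf// expf_neq0.
Qed.

Lemma fejer_tail N u : (0 < N)%N ->
  fejer N u * (2 - 2 * cos (2 * pi * u)) <= 4 / N%:R ^+ 2.
Proof.
move=> N0; rewrite mulrAC ler_pM2r ?invr_gt0 ?exprn_gt0 ?ltr0n//.
rewrite -sqnorm_1Bexpi mulrC -sqnormM.
have -> : \sum_(k < N) fexp k u = \sum_(k < N) expi (2 * pi * u) ^+ k.
  apply: eq_bigr => k _; rewrite -expiMn -mulr_natr /fexp; congr expi; ring.
rewrite (_ : (1 - _) * _ = 1 - expi (2 * pi * u *+ N)); last first.
  by rewrite expiMn -opprB mulNr -subrX1 opprB.
rewrite sqnorm_1Bexpi; have := cos_geN1 (2 * pi * u *+ N); lra.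
Qed.

End Fejer.

(** * Expansion of the DOST functions in exponentials *)

Section DOSTExpansion.
Variable R : realType.

Lemma betaS n : beta n.+1 = (2 ^ n)%N.
Proof. by case: n => [|n]//; rewrite /beta subn1. Qed.

Lemma beta_posz n : beta `|n.+1%:Z| = (2 ^ n)%N.
Proof. exact: betaS. Qed.

Lemma beta_negz n : beta `|Negz n| = (2 ^ n)%N.
Proof. exact: betaS. Qed.

Definition band_coef (n tau j : nat) : R[i] :=
  cR (Num.sqrt ((2 ^ n)%:R))^-1 *
  expi (- (2 * pi * (2 ^ n + j)%:R * tau%:R / (2 ^ n)%:R)).

Definition DOST_coef (p : int) (tau j : nat) : R[i] :=
  match p with
  | Posz 0 => 1
  | Posz n.+1 => band_coef n tau j
  | Negz n => (band_coef n tau j)^*%C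
  end.

Definition DOST_freq (p : int) (j : nat) : int :=
  match p with
  | Posz 0 => 0
  | Posz n.+1 => (2 ^ n + j)%:Z
  | Negz n => - (2 ^ n + j)%:Z
  end.

Lemma DOSTnatS n tau (t : R) : DOSTnat n.+1 tau t =
  \sum_(j < 2 ^ n) band_coef n tau j * fexp (2 ^ n + j)%:Z t.
Proof.
case: n => [|n].
  rewrite big_ord1 /band_coef [ord0 : nat]/= addn0 expn0.
  rewrite sqrtr1 invr1 mul1r !mulr1 expiN.
  rewrite (expi2pi_int R tau) conjc1 mul1r /fexp /=.
  by congr expi; ring.
rewrite /DOSTnat betaS /nu !subSS subn0 subn0.
have -> : (2 ^ n.+1 %/ 2 = 2 ^ n)%N by rewrite expnS mulKn.
have -> : (2 ^ n.+1 + 2 ^ n + 2 ^ n = 2 ^ n.+1 + 2 ^ n.+1)%N.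
  by rewrite -addnA addnn -mul2n -expnS.
rewrite addnK.
rewrite -[X in index_iota X _]add0n big_addn addnK big_mkord mulr_sumr.
apply: eq_bigr => j _; rewrite /band_coef -[RHS]mulrA; congr (_ * _).
by rewrite [LHS]mulrC (addnC j).
Qed.

Lemma DOST_expansion p tau (t : R) : DOST p tau t =
  \sum_(j < beta `|p|) DOST_coef p tau j * fexp (DOST_freq p j) t.
Proof.
case: p => [[|n]|n].
- by rewrite big_ord1 fexp0 mulr1.
- by rewrite -[LHS]/(DOSTnat n.+1 tau t) DOSTnatS beta_posz.
- rewrite -[LHS]/((DOSTnat n.+1 tau t)^*%C) DOSTnatS beta_negz.
  rewrite rmorph_sum; apply: eq_bigr => j _.
  by rewrite fexpN -conjcM.
Qed.

Lemma band_coef_unitary n tau sigma : (tau < 2 ^ n)%N -> (sigma < 2 ^ n)%N ->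
  \sum_(j < 2 ^ n) band_coef n tau j * (band_coef n sigma j)^*%C =
  if tau == sigma then 1 else 0.
Proof.
move=> taun sigman.
have b0 : (2 ^ n)%:R != 0 :> R by rewrite pnatr_eq0 expn_eq0.
under eq_bigr => j _.
  rewrite (_ : _ * _ = ((2 ^ n)%:R)^-1 *
     expi (2 * pi * j%:R * (sigma%:R - tau%:R) / (2 ^ n)%:R)); last first.
    rewrite /band_coef conjcM mulrACA; congr (_ * _).
      by rewrite [X in _ * X]conjc_real -cRM -invfM -expr2 sqr_sqrtr// cRV cR_nat.
    rewrite -expiN opprK -expiD.
    rewrite -[LHS]mulr1 -(expi2pi_int R (tau%:Z - sigma%:Z)) -expiD; congr expi.
    by rewrite intrB !natrD; field.
  over.
rewrite -mulr_sumr sum_expi_roots// eq_sym.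
by case: eqP; rewrite ?mulr0// mulVf// pnatr_eq0 expn_eq0.
Qed.

Lemma DOST_coef_unitary p tau sigma : DOST_index p tau -> DOST_index p sigma ->
  \sum_(j < beta `|p|) DOST_coef p tau j * (DOST_coef p sigma j)^*%C =
  if tau == sigma then 1 else 0.
Proof.
rewrite /DOST_index; case: p => [[|n]|n].
- by case: tau; case: sigma => // _ _; rewrite big_ord1 conjc1 mulr1.
- rewrite beta_posz; exact: band_coef_unitary.
- rewrite beta_negz => taun sigman.
  rewrite (eq_sym tau) -(@band_coef_unitary n)//; apply: eq_bigr => j _.
  by rewrite conjcK mulrC.
Qed.

(* A one-sided inverse of a square matrix is two-sided. *)
Lemma DOST_coef_counitary p j k : DOST_index p j -> DOST_index p k ->
  \sum_(tau < beta `|p|) (DOST_coef p tau j)^*%C * DOST_coef p tau k =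
  if j == k then 1 else 0.
Proof.
rewrite /DOST_index => jb kb.
pose A : 'M[R[i]]_(beta `|p|) := \matrix_(tau, j) DOST_coef p tau j.
pose B : 'M[R[i]]_(beta `|p|) := \matrix_(j, tau) (DOST_coef p tau j)^*%C.
have : A *m B = 1%:M.
  apply/matrixP => s t; rewrite !mxE -(inj_eq val_inj).
  rewrite (_ : (_ == _)%:R = if val s == val t then 1 else 0); last by case: eqP.
  rewrite -(@DOST_coef_unitary p _ _ (ltn_ord s) (ltn_ord t)).
  by apply: eq_bigr => i _; rewrite !mxE.
move=> /mulmx1C /matrixP /(_ (Ordinal jb) (Ordinal kb)).
rewrite !mxE -(inj_eq val_inj) /= => H.
transitivity ((j == k)%:R : R[i]); last by case: eqP.
by rewrite -H; apply: eq_bigr => i _; rewrite !mxE.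
Qed.

Lemma DOST_freq_inj p q j k : DOST_index p j -> DOST_index q k ->
  DOST_freq p j = DOST_freq q k -> p = q /\ j = k.
Proof.
have pos n i : (0 < 2 ^ n + i)%N by rewrite addn_gt0 expn_gt0.
have key m n i l : (i < 2 ^ m)%N -> (l < 2 ^ n)%N ->
    (2 ^ m + i = 2 ^ n + l)%N -> m = n /\ i = l.
  move=> im ln e.
  have tl r s : (s < 2 ^ r)%N -> trunc_log 2 (2 ^ r + s) = r.
    move=> sr; apply: trunc_log_eq => //.
    by rewrite leq_addr expnS mul2n -addnn ltn_add2l.
  have mn : m = n by rewrite -(tl _ _ im) e tl.
  by subst n; split => //; lia.
rewrite /DOST_index; case: p => [[|m]|m]; case: q => [[|n]|n];
  rewrite /DOST_freq ?beta_posz ?beta_negz.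
- by case: j; case: k.
- by move=> _ _ ; have := pos n k; lia.
- by move=> _ _ ; have := pos n k; lia.
- by move=> _ _ ; have := pos m j; lia.
- by move=> jm kn [] /(key _ _ _ _ jm kn) [-> ->].
- by move=> _ _; have := pos m j; lia.
- by move=> _ _ ; have := pos m j; lia.
- by move=> _ _; have := pos m j; lia.
- by move=> jm kn /oppr_inj [] /(key _ _ _ _ jm kn) [-> ->].
Qed.

Lemma DOST_freq_surj (k : int) : exists p j, DOST_index p j /\ DOST_freq p j = k.
Proof.
have key m : (0 < m)%N -> exists n j, (j < 2 ^ n)%N /\ (2 ^ n + j)%N = m.
  move=> m0; have /andP[lo hi] := trunc_log_bounds (isT : (1 < 2)%N) m0.
  exists (trunc_log 2 m), (m - 2 ^ trunc_log 2 m)%N; split; last by rewrite subnKC.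
  by rewrite ltn_subLR// addnn -mul2n -expnS.
case: k => [[|m]|m].
- by exists 0, 0%N.
- have [//|n [j [jn e]]] := key m.+1; exists n.+1%:Z, j.
  by rewrite /DOST_index beta_posz /DOST_freq e.
- have [//|n [j [jn e]]] := key m.+1; exists (Negz n), j.
  by rewrite /DOST_index beta_negz /DOST_freq e NegzE.
Qed.

Lemma fexp_DOST p j (t : R) : DOST_index p j ->
  fexp (DOST_freq p j) t =
  \sum_(tau < beta `|p|) (DOST_coef p tau j)^*%C * DOST p tau t.
Proof.
move=> jb; under eq_bigr => tau _ do rewrite DOST_expansion mulr_sumr.
rewrite exchange_big /= (bigD1 (Ordinal jb))//= [X in _ + X]big1 ?addr0.
  under eq_bigr => tau _ do rewrite mulrA.
  by rewrite -mulr_suml DOST_coef_counitary// eqxx mul1r.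
move=> k; rewrite -(inj_eq val_inj) /= => kj.
under eq_bigr => tau _ do rewrite mulrA.
rewrite -mulr_suml DOST_coef_counitary//; last exact: ltn_ord.
by rewrite eq_sym (negbTE kj) mul0r.
Qed.

End DOSTExpansion.

(** * Integration of continuous complex functions *)

Section ContinuousComplex.
Variable R : realType.
Notation mu := (@lebesgue_measure R).

Definition ccontinuous (h : R -> R[i]) : Prop :=
  continuous (fun t => complex.Re (h t)) /\
  continuous (fun t => complex.Im (h t)).

Lemma ccontinuous_cst (c : R[i]) : ccontinuous (fun=> c).
Proof. by split => t; exact: cvg_cst. Qed.

Lemma ccontinuousD (f g : R -> R[i]) : ccontinuous f -> ccontinuous g ->
  ccontinuous (fun t => f t + g t).
Proof.
move=> [f1 f2] [g1 g2]; split => t.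
- under [X in continuous_at _ X]eq_fun do rewrite cReD.
  by apply: cvgD; [exact: f1|exact: g1].
- under [X in continuous_at _ X]eq_fun do rewrite cImD.
  by apply: cvgD; [exact: f2|exact: g2].
Qed.

Lemma ccontinuousM (f g : R -> R[i]) : ccontinuous f -> ccontinuous g ->
  ccontinuous (fun t => f t * g t).
Proof.
move=> [f1 f2] [g1 g2]; split => t.
- under [X in continuous_at _ X]eq_fun do rewrite cReM.
  by apply: cvgB; apply: cvgM;
    [exact: f1|exact: g1|exact: f2|exact: g2].
- under [X in continuous_at _ X]eq_fun do rewrite cImM.
  by apply: cvgD; apply: cvgM;
    [exact: f1|exact: g2|exact: f2|exact: g1].
Qed.

Lemma ccontinuous_sum I (r : seq I) (F : I -> R -> R[i]) :
  (forall i, ccontinuous (F i)) -> ccontinuous (fun t => \sum_(i <- r) F i t).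
Proof.
move=> cF; elim: r => [|i r IHr].
  by under [X in ccontinuous X]eq_fun do rewrite big_nil; exact: ccontinuous_cst.
under [X in ccontinuous X]eq_fun do rewrite big_cons.
exact: ccontinuousD.
Qed.

Lemma continuous_scale (w : R) : continuous (fun t : R => w * t).
Proof. by move=> t; apply: cvgM; [exact: cvg_cst|exact: cvg_id]. Qed.

Lemma ccontinuous_fexp k : ccontinuous (@fexp R k).
Proof.
split => t /=; apply: continuous_comp; try exact: continuous_scale.
- exact: continuous_cos.
- exact: continuous_sin.
Qed.

Lemma continuous_integrable_I01 (f : R -> R) : continuous f ->
  mu.-integrable I01 (EFin \o f).
Proof.
move=> cf; apply: continuous_compact_integrable; first exact: segment_compact.
exact: continuous_subspaceT.
Qed.

Lemma measurable_I01 : measurable (@I01 R).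
Proof. exact: measurable_itv. Qed.

Lemma measure_I01 : mu (@I01 R) = 1%E.
Proof. by rewrite /I01 lebesgue_measure_itv/= lte01 oppr0 adde0. Qed.

Lemma ccontinuous_L2 (f : R -> R[i]) : ccontinuous f -> L2_01 f.
Proof.
move=> [f1 f2]; split; [|split].
- by apply: measurable_funTS; exact: continuous_measurable_fun.
- by apply: measurable_funTS; exact: continuous_measurable_fun.
have /integrableP[_] : mu.-integrable I01 (EFin \o (fun t => sqnorm (f t))).
  apply: continuous_integrable_I01 => t; rewrite /sqnorm.
  by apply: cvgD; apply: cvgM;
    (exact: f1 || exact: f2).
under eq_integral => t _ do rewrite /= ger0_norm ?sqnorm_ge0//.
by [].
Qed.

Lemma cint01D (f g : R -> R[i]) : ccontinuous f -> ccontinuous g ->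
  cint01 (fun t => f t + g t) = cint01 f + cint01 g.
Proof.
move=> [f1 f2] [g1 g2]; apply: complexP.
  rewrite cReD /=.
  under eq_Rintegral do rewrite cReD.
  by rewrite RintegralD//; [exact: measurable_I01|
    exact: continuous_integrable_I01|exact: continuous_integrable_I01].
rewrite cImD /=.
under eq_Rintegral do rewrite cImD.
by rewrite RintegralD//; [exact: measurable_I01|
  exact: continuous_integrable_I01|exact: continuous_integrable_I01].
Qed.

Lemma cint01Z (c : R[i]) (f : R -> R[i]) : ccontinuous f ->
  cint01 (fun t => c * f t) = c * cint01 f.
Proof.
move=> [f1 f2].
have iZ (a : R) (g : R -> R) : continuous g ->
    mu.-integrable I01 (EFin \o (fun t => a * g t)).
  move=> cg; apply: continuous_integrable_I01 => t.
  by apply: cvgM; [exact: cvg_cst|exact: cg].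
apply: complexP.
  rewrite cReM /=.
  under eq_Rintegral do rewrite cReM.
  rewrite RintegralB//; [|exact: measurable_I01|exact: iZ|exact: iZ].
  by rewrite !RintegralZl//;
    (exact: measurable_I01 || exact: continuous_integrable_I01).
rewrite cImM /=.
under eq_Rintegral do rewrite cImM.
rewrite RintegralD//; [|exact: measurable_I01|exact: iZ|exact: iZ].
by rewrite !RintegralZl//;
  (exact: measurable_I01 || exact: continuous_integrable_I01).
Qed.

Lemma cint01_sum I (r : seq I) (F : I -> R -> R[i]) :
  (forall i, ccontinuous (F i)) ->
  cint01 (fun t => \sum_(i <- r) F i t) = \sum_(i <- r) cint01 (F i).
Proof.
move=> cF; elim: r => [|i r IHr].
  rewrite big_nil; under [X in cint01 X]eq_fun do rewrite big_nil.
  by apply: complexP; rewrite /= Rintegral_cst ?mul0r//; exact: measurable_I01.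
rewrite big_cons -IHr -cint01D//; last exact: ccontinuous_sum.
by congr cint01; apply/funext => t; rewrite big_cons.
Qed.

Lemma Rintegral_FTC (f F : R -> R) : continuous f ->
  (forall x : R, is_derive x 1 F (f x)) ->
  Rintegral mu I01 f = F 1 - F 0.
Proof.
move=> cf dF; have cF : continuous F.
  by move=> x; apply/differentiable_continuous/derivable1_diffP; have [] := dF x.
rewrite /Rintegral (@continuous_FTC2 _ f F 0 1)//.
- exact: continuous_subspaceT.
- split.
  + by move=> x _; have [] := dF x.
  + by apply: cvg_at_right_filter; exact: cF.
  + by apply: cvg_at_left_filter; exact: cF.
- by move=> x _; rewrite derive1E; have [] := dF x.
Qed.

Lemma is_derive_scale (w x : R) : is_derive x 1 (fun t : R => w * t) w.
Proof. by apply: is_derive_eq; rewrite /GRing.scale /= mulr1. Qed.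

Lemma cint01_fexp (k : int) : cint01 (@fexp R k) = if k == 0 then 1 else 0.
Proof.
case: eqVneq => [->|k0].
  have -> : @fexp R 0 = fun=> 1 by apply/funext => t; rewrite fexp0.
  rewrite /cint01; apply: complexP => /=; rewrite Rintegral_cst ?mul0r//;
    try exact: measurable_I01.
  by rewrite mul1r [X in fine X]measure_I01.
set w : R := 2 * pi * k%:~R.
have w0 : w != 0.
  by rewrite /w !mulf_eq0 !negb_or pnatr_eq0 intr_eq0 k0 (gt_eqF (pi_gt0 _)).
have [cw sw] : Complex (cos w) (sin w) = Complex 1 0 := expi2pi_int R k.
have cc : continuous (fun t => cos (w * t)).
  by move=> t; apply: continuous_comp;
    [exact: continuous_scale|exact: continuous_cos].
have cs : continuous (fun t => sin (w * t)).
  by move=> t; apply: continuous_comp;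
    [exact: continuous_scale|exact: continuous_sin].
have dS (x : R) : is_derive x 1 (fun t : R => w^-1 * sin (w * t)) (cos (w * x)).
  have ds := is_derive1_comp (is_derive_sin (w * x)) (is_derive_scale w x).
  apply: is_derive_eq; rewrite /GRing.scale /=.
  by field.
have dC (x : R) : is_derive x 1 (fun t : R => - w^-1 * cos (w * t)) (sin (w * x)).
  have ds := is_derive1_comp (is_derive_cos (w * x)) (is_derive_scale w x).
  apply: is_derive_eq; rewrite /GRing.scale /=.
  by field.
apply: complexP; rewrite /= -/w.
- by rewrite (Rintegral_FTC cc dS) mulr1 mulr0 sw sin0 subrr.
- by rewrite (Rintegral_FTC cs dC) mulr1 mulr0 cw cos0 subrr.
Qed.

End ContinuousComplex.

(** * Orthonormality and span *)

Section Orthonormality.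
Variable R : realType.

Lemma ccontinuous_DOST p tau : ccontinuous (@DOST R p tau).
Proof.
have -> : @DOST R p tau = fun t =>
    \sum_(j < beta `|p|) DOST_coef R p tau j * fexp (DOST_freq p j) t.
  by apply/funext => t; exact: DOST_expansion.
apply: ccontinuous_sum => j; apply: ccontinuousM; first exact: ccontinuous_cst.
exact: ccontinuous_fexp.
Qed.

Lemma DOST_orthonormal p q tau sigma : DOST_index p tau -> DOST_index q sigma ->
  inner01 (@DOST R p tau) (DOST q sigma) =
  if (p, tau) == (q, sigma) then 1 else 0.
Proof.
move=> ptau qsigma.
have cE (c : R[i]) k : ccontinuous (fun t : R => c * fexp k t).
  by apply: ccontinuousM; [exact: ccontinuous_cst|exact: ccontinuous_fexp].
have -> : inner01 (@DOST R p tau) (DOST q sigma) =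
    \sum_(j < beta `|p|) \sum_(k < beta `|q|)
      DOST_coef R p tau j * (DOST_coef R q sigma k)^*%C *
      (if DOST_freq p j == DOST_freq q k then 1 else 0).
  transitivity (cint01 (fun t : R => \sum_(j < beta `|p|) \sum_(k < beta `|q|)
      DOST_coef R p tau j * (DOST_coef R q sigma k)^*%C *
      fexp (DOST_freq p j - DOST_freq q k) t)).
    congr cint01; apply/funext => t; rewrite !DOST_expansion mulr_suml.
    apply: eq_bigr => j _; rewrite (rmorph_sum (@conjc R)) mulr_sumr.
    by apply: eq_bigr => k _; rewrite [X in _ * X]conjcM mulrACA fexpD fexpN.
  rewrite cint01_sum; last by move=> j; apply: ccontinuous_sum => k; exact: cE.
  apply: eq_bigr => j _; rewrite cint01_sum; last by move=> k; exact: cE.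
  apply: eq_bigr => k _; rewrite cint01Z; last exact: ccontinuous_fexp.
  by rewrite cint01_fexp subr_eq0.
have [pq|pq] := eqVneq p q; last first.
  rewrite xpair_eqE (negbTE pq) /= big1// => j _; rewrite big1// => k _.
  case: eqP => [e|_]; last by rewrite mulr0.
  have [e' _] := DOST_freq_inj (ltn_ord j : DOST_index p j)
    (ltn_ord k : DOST_index q k) e.
  by rewrite e' eqxx in pq.
subst q; rewrite xpair_eqE eqxx /= -(DOST_coef_unitary R ptau qsigma).
apply: eq_bigr => j _; rewrite (bigD1 j)//= eqxx mulr1 big1 ?addr0// => k kj.
case: eqP => [e|_]; last by rewrite mulr0.
have [_ /val_inj e'] := DOST_freq_inj (ltn_ord j : DOST_index p j)
  (ltn_ord k : DOST_index p k) e.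
by rewrite e' eqxx in kj.
Qed.

Definition in_span (I : eqType) (valid : pred I) (e : I -> R -> R[i])
    (h : R -> R[i]) : Prop :=
  exists s : seq (I * R[i]), all (fun x => valid x.1) s /\
    h = fun t => \sum_(x <- s) x.2 * e x.1 t.

Section Span.
Variables (I : eqType) (valid : pred I) (e : I -> R -> R[i]).
Local Notation span := (in_span valid e).

Lemma in_span0 : span (fun=> 0).
Proof. by exists [::]; split => //; apply/funext => t; rewrite big_nil. Qed.

Lemma in_span1 i : valid i -> span (e i).
Proof.
move=> vi; exists [:: (i, 1)]; split; rewrite /= ?vi//.
by apply/funext => t; rewrite big_seq1 mul1r.
Qed.

Lemma in_spanD f g : span f -> span g -> span (fun t => f t + g t).
Proof.
move=> [s [vs ->]] [r [vr ->]]; exists (s ++ r); split.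
  by rewrite all_cat vs.
by apply/funext => t; rewrite big_cat.
Qed.

Lemma in_spanZ c f : span f -> span (fun t => c * f t).
Proof.
move=> [s [vs ->]]; exists [seq (x.1, c * x.2) | x <- s]; split.
  by rewrite all_map.
apply/funext => t; rewrite big_map mulr_sumr.
by apply: eq_bigr => x _; rewrite mulrA.
Qed.

Lemma in_span_sum J (r : seq J) (F : J -> R -> R[i]) :
  (forall j, span (F j)) -> span (fun t => \sum_(j <- r) F j t).
Proof.
move=> sF; elim: r => [|j r IHr].
  by under [X in span X]eq_fun do rewrite big_nil; exact: in_span0.
by under [X in span X]eq_fun do rewrite big_cons; exact: in_spanD.
Qed.

End Span.

Definition in_DOST_span : (R -> R[i]) -> Prop :=
  in_span (fun i : int * nat => DOST_index i.1 i.2)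
    (fun i => @DOST R i.1 i.2).

Lemma fexp_in_DOST_span k : in_DOST_span (fexp k).
Proof.
have [p [j [jp <-]]] := DOST_freq_surj k.
have -> : @fexp R (DOST_freq p j) = fun t =>
    \sum_(tau < beta `|p|) (DOST_coef R p tau j)^*%C * DOST p tau t.
  by apply/funext => t; exact: fexp_DOST.
apply: in_span_sum => tau; apply: in_spanZ.
apply: (@in_span1 _ _ (fun i => @DOST R i.1 i.2) (p, val tau)).
exact: (ltn_ord tau).
Qed.

Definition fejer_interp (N : nat) (g : R -> R) (t : R) : R :=
  \sum_(j < N) g (j%:R / N%:R) * fejer N (t - j%:R / N%:R).

Lemma fejer_interp_in_DOST_span N (g h : R -> R) :
  in_DOST_span (fun t => Complex (fejer_interp N g t) (fejer_interp N h t)).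
Proof.
have -> : (fun t => Complex (fejer_interp N g t) (fejer_interp N h t)) =
    fun t => \sum_(j < N) Complex (g (j%:R / N%:R)) (h (j%:R / N%:R)) *
      ((N%:R ^+ 2)^-1 * \sum_(k < N) \sum_(l < N)
        fexp (k%:Z - l%:Z) (- (j%:R / N%:R)) * fexp (k%:Z - l%:Z) t).
  apply/funext => t; transitivity (\sum_(j < N)
      Complex (g (j%:R / N%:R)) (h (j%:R / N%:R)) *
      cR (fejer N (t - j%:R / N%:R))).
    apply: complexP; rewrite ?cRe_sum ?cIm_sum; apply: eq_bigr => j _.
      by rewrite cReM /= mulr0 subr0.
    by rewrite cImM /= mulr0 add0r.
  apply: eq_bigr => j _; rewrite fejer_fexp; congr (_ * (_ * _)).
  by apply: eq_bigr => k _; apply: eq_bigr => l _; rewrite fexp_tD mulrC.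
apply: in_span_sum => j; do 2 apply: in_spanZ.
apply: in_span_sum => k; apply: in_span_sum => l; apply: in_spanZ.
exact: fexp_in_DOST_span.
Qed.

Lemma continuous_fejer_interp N (g : R -> R) : continuous (fejer_interp N g).
Proof.
have [s [_ sE]] := fejer_interp_in_DOST_span N g g.
suff : ccontinuous (fun t => Complex (fejer_interp N g t) (fejer_interp N g t)).
  by case.
rewrite sE; apply: ccontinuous_sum => x; apply: ccontinuousM.
  exact: ccontinuous_cst.
exact: ccontinuous_DOST.
Qed.

End Orthonormality.

(** * Density of trigonometric polynomials *)

Section FejerConvergence.
Variable R : realType.
Implicit Types (t s u d M : R) (g : R -> R).

Lemma ler_cos0pi u d : 0 <= d -> d <= u -> u <= pi -> cos u <= cos d.
Proof.
move=> d0; rewrite le_eqVlt => /predU1P[->//|du upi].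
by apply: ltW; rewrite ltr_cos ?in_itv/=; lra.
Qed.

Lemma cos2pi_away u d : 0 <= d -> d <= `|u| -> `|u| <= 1 - d ->
  cos (2 * pi * u) <= cos (2 * pi * d).
Proof.
move=> d0 du ud; have pi0 := pi_gt0 R.
have -> : cos (2 * pi * u) = cos (2 * pi * `|u|).
  by rewrite -cos_norm normrM ger0_norm ?mulr_ge0// ltW.
have [u2|u2] := leP `|u| (2^-1).
  by apply: ler_cos0pi; nra.
have -> : cos (2 * pi * `|u|) = cos (2 * pi * (1 - `|u|)).
  rewrite -[RHS]cosN -[RHS]cosD2pi; congr cos; rewrite -mulr_natl; ring.
by apply: ler_cos0pi; nra.
Qed.

Lemma cos2pi_lt1 d : 0 < d <= 2^-1 -> cos (2 * pi * d) < 1.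
Proof.
move=> /andP[d0 d2]; have pi0 := pi_gt0 R.
by rewrite -[ltRHS]cos0 ltr_cos ?in_itv/= ?lexx; nra.
Qed.

Lemma fejer_interp_le N g M t : (forall s, `|g s| <= M) ->
  `|fejer_interp N g t| <= M.
Proof.
move=> gM; have M0 : 0 <= M by apply: le_trans (gM 0); exact: normr_ge0.
case: N => [|N]; first by rewrite /fejer_interp big_ord0 normr0.
apply: le_trans (ler_norm_sum _ _ _) _.
have -> : M = \sum_(j < N.+1) M * fejer N.+1 (t - j%:R / N.+1%:R).
  by rewrite -mulr_sumr sum_fejer ?mulr1.
apply: ler_sum => j _.
rewrite normrM (ger0_norm (fejer_ge0 _ _)).
by apply: ler_wpM2r; [exact: fejer_ge0|exact: gM].
Qed.

(* Splitting the nodes by their distance to [t]: near nodes carry total mass at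
   most 1 and each of the [N] far ones has mass [O(1 / N ^ 2)]. *)
Lemma fejer_interp_dist N g M t d e : (0 < N)%N -> 0 < e ->
  (forall s, `|g s| <= M) -> 0 < d -> d <= t -> d <= 1 - t ->
  (forall s, `|t - s| < d -> `|g t - g s| <= e) ->
  `|g t - fejer_interp N g t| <=
    e + 8 * M / ((2 - 2 * cos (2 * pi * d)) * N%:R).
Proof.
move=> N0 e0 gM d0 dt dt1 ge; set c := 2 - 2 * _.
have c0 : 0 < c.
  have /cos2pi_lt1 : 0 < d <= 2^-1 by lra.
  by rewrite /c; lra.
have M0 : 0 <= M by apply: le_trans (gM 0); exact: normr_ge0.
have NR : 0 < N%:R :> R by rewrite ltr0n.
have -> : g t - fejer_interp N g t =
    \sum_(j < N) (g t - g (j%:R / N%:R)) * fejer N (t - j%:R / N%:R).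
  under [RHS]eq_bigr => j _ do rewrite mulrBl.
  by rewrite sumrB -mulr_sumr sum_fejer// mulr1.
apply: le_trans (ler_norm_sum _ _ _) _.
have -> : e + 8 * M / (c * N%:R) =
    \sum_(j < N) (e * fejer N (t - j%:R / N%:R) +
                  2 * M / c * (4 / N%:R ^+ 2)).
  rewrite big_split /= -mulr_sumr sum_fejer// mulr1; congr (_ + _).
  rewrite sumr_const card_ord -[RHS]mulr_natr; field.
  by rewrite !gt_eqF.
apply: ler_sum => j _; set s := j%:R / N%:R.
rewrite normrM (ger0_norm (fejer_ge0 _ _)).
have K0 := fejer_ge0 N (t - s).
have [ds|ds] := ltP `|t - s| d.
  apply: ler_wpDr; last by apply: ler_wpM2r => //; exact: ge.
  by rewrite mulr_ge0 ?divr_ge0 ?mulr_ge0 ?exprn_ge0// ltW.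
apply: ler_wpDl; first by rewrite mulr_ge0// ltW.
have s01 : 0 <= s <= 1.
  by rewrite divr_ge0//= ler_pdivrMr// mul1r ler_nat ltnW.
have cs : c <= 2 - 2 * cos (2 * pi * (t - s)).
  suff : cos (2 * pi * (t - s)) <= cos (2 * pi * d) by rewrite /c; lra.
  apply: cos2pi_away => //; first exact: ltW.
  by rewrite ler_norml; lra.
have g2 : `|g t - g s| <= 2 * M.
  by apply: le_trans (ler_normB _ _) _; have := gM t; have := gM s; lra.
apply: (@le_trans _ _ (2 * M * fejer N (t - s))); first exact: ler_wpM2r.
rewrite -[leRHS]mulrA ler_wpM2l ?mulr_ge0// mulrC ler_pdivlMr//.
apply: le_trans (fejer_tail (t - s) N0).
exact: ler_wpM2l.
Qed.

Lemma fejer_interp_cvg g M t : (forall s, `|g s| <= M) -> {for t, continuous g} ->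
  0 < t < 1 -> fejer_interp N g t @[N --> \oo] --> g t.
Proof.
move=> gM cg /andP[t0 t1]; apply/cvgrPdist_le => e e0.
have e20 : 0 < e / 2 by rewrite divr_gt0.
have /cvgrPdist_le /(_ (e / 2) e20) /nbhs_ballP[d' /= d'0 hd'] := cg.
pose d := Num.min d' (Num.min t (1 - t)).
have d0 : 0 < d by rewrite !lt_min d'0 t0 subr_gt0.
have dt : d <= t by rewrite !ge_min lexx /= orbT.
have dt1 : d <= 1 - t by rewrite !ge_min lexx !orbT.
have gd s : `|t - s| < d -> `|g t - g s| <= e / 2.
  move=> ts; apply: hd'; apply: lt_le_trans ts _.
  by rewrite ge_min lexx.
clearbody d; pose c := 2 - 2 * cos (2 * pi * d).
have c0 : 0 < c.
  have /cos2pi_lt1 : 0 < d <= 2^-1 by lra.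
  by rewrite /c; lra.
near=> N.
have N0 : (0 < N)%N by near: N; exact: nbhs_infty_gt.
have NR : 0 < N%:R :> R by rewrite ltr0n.
apply: le_trans (fejer_interp_dist N0 e20 gM d0 dt dt1 gd) _.
rewrite -/c [leRHS](splitr e) lerD2l ler_pdivrMr ?mulr_gt0//.
have : 16 * M / (c * e) <= N%:R by near: N; exact: nbhs_infty_ger.
by rewrite ler_pdivrMr ?mulr_gt0//; lra.
Unshelve. all: by end_near. Qed.

End FejerConvergence.

Section SquareMean.
Variable R : realType.
Notation mu := (@lebesgue_measure R).
Implicit Types (f g h : R -> R) (M x y : R).

Definition sqmean f : \bar R := (\int[mu]_(t in @I01 R) (f t ^+ 2)%:E)%E.

Lemma measurable_sqr f : measurable_fun I01 f ->
  measurable_fun I01 (fun t => (f t ^+ 2)%:E).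
Proof. by move=> mf; apply/measurable_EFinP; exact: measurable_funX. Qed.

Lemma cvge0_near_lt (u : nat -> \bar R) : u @ \oo --> 0%E ->
  forall e : R, 0 < e -> \forall n \near \oo, (u n < e%:E)%E.
Proof.
move=> /fine_cvgP[fu /cvgrPdist_lt u0] e e0.
near=> n.
have fn : u n \is a fin_num by near: n; exact: fu.
have : `|0 - fine (u n)| < e by near: n; exact: u0.
rewrite sub0r normrN => /ltr_normlW.
by rewrite -lte_fin fineK.
Unshelve. all: by end_near. Qed.

Lemma sqmean_dominated (f_ : nat -> R -> R) (b : R -> R) :
  (forall n, measurable_fun I01 (f_ n)) -> mu.-integrable I01 (EFin \o b) ->
  (forall n t, I01 t -> f_ n t ^+ 2 <= b t) ->
  (forall t, 0 < t < 1 -> f_ n t @[n --> \oo] --> 0) ->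
  forall e : R, 0 < e -> \forall n \near \oo, (sqmean (f_ n) < e%:E)%E.
Proof.
move=> mf ib fb f0; apply: cvge0_near_lt.
have := @dominated_convergence _ _ R mu I01 (@measurable_I01 R)
  (fun n t => (f_ n t ^+ 2)%:E) (fun=> 0%E) (EFin \o b).
case.
- by move=> n; exact: measurable_sqr.
- exact: measurable_cst.
- exists ([set 0] `|` [set 1]); split.
  + exact: measurableU.
  + by apply: null_set_setU => //; exact: lebesgue_measure_set1.
  + move=> t /= nt; apply: contrapT => t01; apply: nt => /=.
    rewrite /I01 /= in_itv /= => /andP[t0 t1].
    have t01' : 0 < t < 1.
      by rewrite !lt_neqAle t0 t1 !andbT; apply/andP; split;
        apply/eqP => tE; apply: t01; [left|right].
    apply: cvg_EFin; first by near=> n.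
    have f2 := cvgM (f0 t t01') (f0 t t01'); rewrite mulr0 in f2.
    exact: f2.
- exact: ib.
- by apply: aeW => t n It; rewrite lee_fin ger0_norm ?sqr_ge0//; exact: fb.
move=> _ _; rewrite integral0; exact.
Unshelve. all: by end_near. Qed.

Lemma sqmean_triangle f g h : measurable_fun I01 f -> measurable_fun I01 g ->
  measurable_fun I01 h ->
  (sqmean (f \- h)%R <= 2%:E * sqmean (f \- g)%R + 2%:E * sqmean (g \- h)%R)%E.
Proof.
move=> mf mg mh; have mI := @measurable_I01 R.
have m2 (u v : R -> R) : measurable_fun I01 u -> measurable_fun I01 v ->
    measurable_fun I01 (fun t => (2%:E * ((u \- v) t ^+ 2)%:E)%E).
  move=> mu' mv; apply: measurable_funeM; apply: measurable_sqr.
  exact: measurable_funB.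
rewrite /sqmean -!ge0_integralZl//; try by
  [apply: measurable_sqr; exact: measurable_funB
  |move=> t _; rewrite lee_fin sqr_ge0].
rewrite -ge0_integralD//; try by
  [exact: m2|move=> t _; rewrite -EFinM lee_fin mulr_ge0 ?sqr_ge0].
apply: ge0_le_integral => //.
- by move=> t _; rewrite lee_fin sqr_ge0.
- by apply: measurable_sqr; exact: measurable_funB.
- by apply: emeasurable_funD; exact: m2.
move=> t _; rewrite -!EFinM -EFinD lee_fin /=.
by have := sqr_ge0 (f t - 2 * g t + h t); lra.
Qed.

Lemma sqmean_triangle_lt f g h (a b : R) : measurable_fun I01 f ->
  measurable_fun I01 g -> measurable_fun I01 h ->
  (sqmean (f \- g)%R < a%:E)%E -> (sqmean (g \- h)%R < b%:E)%E ->
  (sqmean (f \- h)%R < (2 * a + 2 * b)%:E)%E.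
Proof.
move=> mf mg mh fa gb; apply: le_lt_trans (sqmean_triangle mf mg mh) _.
by rewrite (EFinD (2 * a)) (EFinM 2 a) (EFinM 2 b) lteD// lte_pmul2l.
Qed.

Lemma sqmean_fejer_interp g M : continuous g -> (forall s, `|g s| <= M) ->
  forall e : R, 0 < e ->
  \forall N \near \oo, (sqmean (g \- fejer_interp N g)%R < e%:E)%E.
Proof.
move=> cg gM; apply: (@sqmean_dominated _ (fun=> (2 * M) ^+ 2)).
- move=> N; apply: measurable_funTS; apply: continuous_measurable_fun => t.
  apply: cvgB; first exact: cg.
  exact: continuous_fejer_interp.
- by apply: continuous_integrable_I01 => t; exact: cvg_cst.
- move=> N t _ /=; rewrite -[leLHS]real_normK ?num_real//.
  rewrite ler_sqr ?nnegrE//; last first.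
    by rewrite mulr_ge0//; apply: le_trans (gM 0); exact: normr_ge0.
  apply: le_trans (ler_normB _ _) _.
  by have := gM t; have := fejer_interp_le N t gM; lra.
- move=> t t01 /=; rewrite -[X in _ --> X](subrr (g t)).
  apply: cvgB; first exact: cvg_cst.
  by apply: fejer_interp_cvg gM _ t01; exact: cg.
Qed.

Definition clip M x : R := Num.max (- M) (Num.min x M).

Lemma clipP M x : 0 <= M ->
  [\/ x <= - M /\ clip M x = - M, - M <= x <= M /\ clip M x = x |
      M <= x /\ clip M x = M].
Proof.
move=> M0; rewrite /clip; have [xM|Mx] := leP x M; last first.
  by apply: Or33; split; [exact: ltW|apply/max_idPr; lra].
have [Nx|xN] := leP (- M) x; first by apply: Or32.
by apply: Or31; split => //; exact: ltW.
Qed.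

Lemma clip_le M x : 0 <= M -> `|clip M x| <= M.
Proof. by move=> M0; rewrite ler_norml; case: (clipP x M0) => -[+ ->]; lra. Qed.

Lemma clip_lip M x y : 0 <= M -> `|clip M x - clip M y| <= `|x - y|.
Proof.
move=> M0; have := ler_norm (x - y); have := ler_norm (y - x).
rewrite [`|y - x|]distrC ler_norml.
by case: (clipP x M0) => -[+ ->]; case: (clipP y M0) => -[+ ->]; lra.
Qed.

Lemma clip_id M x : `|x| <= M -> clip M x = x.
Proof.
move=> xM; have M0 : 0 <= M := le_trans (normr_ge0 _) xM.
by move: xM; rewrite ler_norml; case: (clipP x M0) => -[+ ->]; lra.
Qed.

Lemma normB_clip M x : 0 <= M -> `|x - clip M x| <= `|x|.
Proof.
move=> M0; have := ler_norm x; have := ler_norm (- x).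
by rewrite normrN ler_norml; case: (clipP x M0) => -[+ ->]; lra.
Qed.

Lemma continuous_clip M g : continuous g -> continuous (clip M \o g).
Proof.
move=> cg t; apply: (@continuous_max _ _ (cst (- M)) (g \min cst M)).
  exact: cvg_cst.
by apply: continuous_min; [exact: cg|exact: cvg_cst].
Qed.

Lemma measurable_clip M f : measurable_fun I01 f ->
  measurable_fun I01 (clip M \o f).
Proof.
move=> mf; apply: measurableT_comp => //; apply: continuous_measurable_fun.
by apply: (@continuous_clip M id) => x; exact: cvg_id.
Qed.

Lemma sqmean_clip f : measurable_fun I01 f -> (sqmean f < +oo)%E ->
  forall e : R, 0 < e ->
  \forall n \near \oo, (sqmean (f \- (clip n%:R \o f))%R < e%:E)%E.
Proof.
move=> mf f2; apply: (@sqmean_dominated _ (fun t => f t ^+ 2)).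
- by move=> n; apply: measurable_funB => //; exact: measurable_clip.
- apply/integrableP; split; first exact: measurable_sqr.
  by under eq_integral do rewrite /= ger0_norm ?sqr_ge0//.
- move=> n t _ /=; rewrite -[leLHS]real_normK ?num_real//.
  rewrite -[leRHS]real_normK ?num_real//.
  by rewrite ler_sqr ?nnegrE//; exact: normB_clip.
- move=> t _; apply: cvg_near_cst; near=> n; rewrite /= clip_id ?subrr//.
  by near: n; exact: nbhs_infty_ger.
Unshelve. all: by end_near. Qed.

Lemma sqmean_bounded_approx f M : 0 <= M -> measurable_fun I01 f ->
  (forall t, `|f t| <= M) -> forall e : R, 0 < e ->
  exists g, [/\ continuous g, forall t, `|g t| <= M & (sqmean (f \- g)%R < e%:E)%E].
Proof.
move=> M0 mf fM e e0; have mI := @measurable_I01 R.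
have fi : mu.-integrable I01 (EFin \o f).
  apply: measurable_bounded_integrable => //.
    by rewrite [ltLHS]measure_I01 ltry.
  exists M; split; first exact: num_real.
  by move=> x Mx t _ /=; apply: le_trans (fM t) (ltW Mx).
have muI : (mu (@I01 R) < +oo)%E by rewrite measure_I01 ltry.
have [g_ [cg _ g0]] := approximation_continuous_integrable mI muI fi.
have e' : 0 < e / (2 * M + 1) by rewrite divr_gt0//; lra.
have [n _ /(_ n (leqnn n)) gn] := cvge0_near_lt g0 e'.
exists (clip M \o g_ n); split.
- exact: continuous_clip.
- by move=> t; exact: clip_le.
have mg : measurable_fun I01 (g_ n).
  by apply: measurable_funTS; exact: continuous_measurable_fun.
have mfg : measurable_fun I01 (fun t => `|(f t - g_ n t)%:E|%E).
  apply: measurableT_comp => //; apply/measurable_EFinP; exact: measurable_funB.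
apply: (@le_lt_trans _ _ (\int[mu]_(t in I01)
    ((2 * M + 1)%:E * `|(f t - g_ n t)%:E|))%E).
  apply: ge0_le_integral => //.
  - by move=> t _; rewrite lee_fin sqr_ge0.
  - by apply: measurable_sqr; apply: measurable_funB => //; exact: measurable_clip.
  - exact: measurable_funeM.
  move=> t _; rewrite abse_EFin -EFinM lee_fin /=.
  rewrite -[leLHS]real_normK ?num_real// expr2.
  apply: ler_pM => //.
    apply: le_trans (ler_normB _ _) _.
    by have := fM t; have := clip_le (g_ n t) M0; lra.
  by rewrite -{1}(clip_id (fM t)); exact: clip_lip.
rewrite ge0_integralZl//; last by rewrite lee_fin; lra.
move: gn; rewrite -(@lte_pmul2l _ (2 * M + 1)%:E)//; last by rewrite lte_fin; lra.
by move/lt_le_trans; apply; rewrite -EFinM lee_fin mulrC divfK// gt_eqF//; lra.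
Qed.

Lemma sqmean_approx f : measurable_fun I01 f -> (sqmean f < +oo)%E ->
  forall e : R, 0 < e -> exists g, \forall N \near \oo,
    (sqmean (f \- fejer_interp N g)%R < e%:E)%E.
Proof.
move=> mf f2 e e0; have e16 : 0 < e / 16 by rewrite divr_gt0.
have [n _ /(_ n (leqnn n)) /= fn] := sqmean_clip mf f2 e16.
have mc : measurable_fun I01 (clip n%:R \o f) by exact: measurable_clip.
have cM t : `|(clip n%:R \o f) t| <= n%:R by exact: clip_le.
have [g [cg gM fg]] := sqmean_bounded_approx (ler0n _ _) mc cM e16.
exists g; near=> N.
have gN : (sqmean (g \- fejer_interp N g)%R < (e / 16)%:E)%E.
  by near: N; exact: sqmean_fejer_interp gM _ e16.
have mg : measurable_fun I01 g.
  by apply: measurable_funTS; exact: continuous_measurable_fun.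
have mT : measurable_fun I01 (fejer_interp N g).
  by apply: measurable_funTS; apply: continuous_measurable_fun => t;
    exact: continuous_fejer_interp.
have gT := sqmean_triangle_lt mc mg mT fg gN.
apply: lt_le_trans (sqmean_triangle_lt mf mc mT fn gT) _.
by rewrite lee_fin; lra.
Unshelve. all: by end_near. Qed.

End SquareMean.

Lemma DOST_dense (R : realType) (f : R -> R[i]) : L2_01 f ->
  forall e : R, 0 < e -> exists h, in_DOST_span h /\ (L2dist2 f h < e%:E)%E.
Proof.
move=> [mRe [mIm fin]] e e0; have e20 : 0 < e / 2 by rewrite divr_gt0.
have mI := @measurable_I01 R.
have mS : measurable_fun I01 (fun t => (sqnorm (f t))%:E).
  by apply/measurable_EFinP; apply: measurable_funD; exact: measurable_funX.
have part (u : R -> R) : measurable_fun I01 u ->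
    (forall t, u t ^+ 2 <= sqnorm (f t)) -> (sqmean u < +oo)%E.
  move=> mu uf; apply: le_lt_trans fin; apply: ge0_le_integral => //.
  - by move=> t _; rewrite lee_fin sqr_ge0.
  - exact: measurable_sqr.
  - by move=> t _; rewrite lee_fin.
have [g gN] : exists g, \forall N \near \oo,
    (sqmean ((fun t => complex.Re (f t)) \- fejer_interp N g)%R < (e / 2)%:E)%E.
  apply: sqmean_approx => //; apply: part => // t.
  by rewrite lerDl sqr_ge0.
have [h hN] : exists h, \forall N \near \oo,
    (sqmean ((fun t => complex.Im (f t)) \- fejer_interp N h)%R < (e / 2)%:E)%E.
  apply: sqmean_approx => //; apply: part => // t.
  by rewrite lerDr sqr_ge0.
have [N _ /(_ N (leqnn N)) [gN' hN']] := filterI gN hN.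
exists (fun t => Complex (fejer_interp N g t) (fejer_interp N h t)); split.
  exact: fejer_interp_in_DOST_span.
have mT k : measurable_fun I01 (@fejer_interp R N k).
  by apply: measurable_funTS; apply: continuous_measurable_fun => t;
    exact: continuous_fejer_interp.
have -> : L2dist2 f (fun t => Complex (fejer_interp N g t) (fejer_interp N h t)) =
    (sqmean ((fun t => complex.Re (f t)) \- fejer_interp N g)%R +
     sqmean ((fun t => complex.Im (f t)) \- fejer_interp N h)%R)%E.
  rewrite -ge0_integralD//; try by
    [apply: measurable_sqr; exact: measurable_funB
    |move=> t _; rewrite lee_fin sqr_ge0].
  apply: eq_integral => t _.
  by rewrite /sqnorm cReD cImD cReN cImN.
by rewrite [e in e%:E]splitr EFinD; apply: lteD.
Qed.

Theorem theorem3p1 (R : realType) :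
  orthonormal_basis_L2_01 (R := R) (I := (int * nat)%type)
    (fun i => DOST_index i.1 i.2) (fun i => @DOST R i.1 i.2).
Proof.
split; [|split].
- by move=> [p tau] _; apply: ccontinuous_L2; exact: ccontinuous_DOST.
- by move=> [p tau] [q sigma]; exact: DOST_orthonormal.
- move=> f /DOST_dense fd e /fd[h [[s [vs ->]] hs]].
  by exists s.
Qed.
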